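(* Let $d_0(q)=1$ and, for $n\ge 1$, let $d_n(q)=\sum_{\sigma\in\mathcal{D}_n}q^{\operatorname{maj}(\sigma)}$, where $\mathcal{D}_n$ is the set of derangements of $[n]$. Then for all integers $n\ge 1$, $$d_n(q) = [n]_q\, d_{n-1}(q) + (-1)^n q^{\binom{n}{2}},$$ and for all integers $n\ge 2$, $$d_n(q) = [n-1]_q\bigl(d_{n-1}(q) + q^{n-1} d_{n-2}(q)\bigr).$$
   Context: Write $[n]=\{1,2,\ldots,n\}$. A derangement of $[n]$ is a permutation $\sigma=\sigma_1\cdots\sigma_n$ of $[n]$ with $\sigma_i\neq i$ for all $i$. The major index is $\operatorname{maj}(\sigma)=\sum_{i\in\operatorname{Des}(\sigma)} i$, where $\operatorname{Des}(\sigma)=\{i: 1\le i\le n-1,\ \sigma_i>\sigma_{i+1}\}$. For a positive integer $m$, $[m]_q=1+q+\cdots+q^{m-1}$. *)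

(* Defs.v *)
From mathcomp Require Import all_boot all_order all_algebra all_fingroup.

Set Implicit Arguments.
Unset Strict Implicit.
Unset Printing Implicit Defensive.

Import GRing.Theory.
Local Open Scope ring_scope.

(* Permutations of [n] = {1, ..., n} are encoded as permutations of
   'I_n = {0, ..., n-1}: the ordinal i stands for the letter (or position)
   i.+1. *)

Definition derangements (n : nat) : {set 'S_n} :=
  [set s : 'S_n | [forall i : 'I_n, s i != i]].

Definition Des (n : nat) (s : 'S_n) : {set 'I_n} :=
  [set i : 'I_n | [exists j : 'I_n, (j == i.+1 :> nat) && (s j < s i)%N]].

Definition maj (n : nat) (s : 'S_n) : nat := (\sum_(i in Des s) i.+1)%N.

(* The indeterminate q is 'X. *)
Definition qint (m : nat) : {poly int} := \sum_(i < m) 'X^i.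

Definition d (n : nat) : {poly int} :=
  if n is 0%N then 1 else \sum_(s in derangements n) 'X^(maj s).

(* Main.v *)
Require Import Defs.
From mathcomp Require Import all_boot all_order all_algebra all_fingroup.
From mathcomp Require Import zify ring.

Set Implicit Arguments.
Unset Strict Implicit.
Unset Printing Implicit Defensive.

Import GRing.Theory.
Local Open Scope ring_scope.

(** The proof follows Wachs.  Write M_n for the sum of q^maj over all permutations
    of n letters and [n, k] for the Gaussian binomial coefficient.

    Remove the fixed points of a permutation and standardize: what remains is a
    derangement of k letters.  A descent between neighbouring positions can be
    read off after classifying positions as excedances (high), deficiencies (low)
    and fixed points, which behave like copies of a single letter lying between
    the low and the high ones.  So the permutations that reduce to a given
    derangement have the descents of the words obtained by shuffling n - k equal
    intermediate letters into it, and the sum of q^maj over these shuffles is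
    [n, k] times q^maj of the derangement ([shuffle_major]).  Therefore M_n is
    the sum of [n, k] d_k over k ([fixed_point_expansion]).  Inserting the
    largest value is another instance of the shuffle theorem, with one inserted
    letter, and gives M_n = [n]_q M_(n-1) ([maj_polyS]).

    Put c_n = d_n - [n]_q d_(n-1) and c_0 = 1.  Since [n, k] [k]_q equals
    [n]_q [n-1, k-1], the two facts say that the sum of [n, k] c_k over k vanishes
    for n >= 1.  The sequence (-1)^n q^(n choose 2) satisfies the same relations
    by the q-binomial theorem ([alternating_expansion]), and these determine a
    sequence ([qbin_unitriangular]); this is the first recurrence.  The second
    one follows from two consecutive instances of the first, in which the
    alternating terms cancel. *)

Local Notation q := ('X : {poly int}).

(** * Gaussian binomial coefficients and q-integers *)

(** This is the Gaussian binomial coefficient of k + f over k.  Indexing it by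
    the sizes k and f of the two parts, rather than by the total, makes both
    Pascal rules free of subtractions and of side conditions. *)
Fixpoint qbin (k : nat) : nat -> {poly int} :=
  if k is k'.+1 then
    fix row (f : nat) : {poly int} :=
      if f is f'.+1 then qbin k' f + q ^+ k'.+1 * row f' else 1
  else fun=> 1.

Arguments qbin : simpl never.

Lemma qbin0 f : qbin 0 f = 1. Proof. by case: f. Qed.

Lemma qbinn k : qbin k 0 = 1. Proof. by case: k. Qed.

Lemma qbinS k f :
  qbin k.+1 f.+1 = qbin k f.+1 + q ^+ k.+1 * qbin k.+1 f.
Proof. by []. Qed.

(** The Pascal rule obtained by exchanging the two parts.  Which of the two
    rules is needed below depends on the position of the last letter of a word
    relative to the inserted letters. *)
Lemma qbinS_dual k f :
  qbin k.+1 f.+1 = q ^+ f.+1 * qbin k f.+1 + qbin k.+1 f.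
Proof.
elim: k f => [|k IHk] f.
  elim: f => [|f IHf]; first by rewrite qbinS qbin0 !qbinn; ring.
  rewrite qbinS {1}IHf [in RHS]qbinS !qbin0 !exprS; ring.
elim: f => [|f IHf].
  by rewrite qbinS {1}(IHk 0%N) [qbin k.+1 1]qbinS !qbinn !exprS; ring.
rewrite qbinS {1}IHf {1}IHk (qbinS k.+1 f) (qbinS k f.+1) !exprS; ring.
Qed.

Lemma qintS n : qint n.+1 = qint n + q ^+ n.
Proof. by rewrite /qint big_ord_recr. Qed.

Lemma qint0 : qint 0 = 0.
Proof. by rewrite /qint big_ord0. Qed.

Lemma qbin_qint k : qbin k 1 = qint k.+1.
Proof.
elim: k => [|k IH]; first by rewrite qbin0 qintS qint0 add0r.
by rewrite qbinS IH qbinn mulr1 [RHS]qintS.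
Qed.

Lemma qint_geometric n : (1 - q) * qint n = 1 - q ^+ n.
Proof.
elim: n => [|n IH]; first by rewrite qint0 expr0; ring.
by rewrite qintS mulrDr IH exprS; ring.
Qed.

Lemma qintD m n : qint (m + n) = qint m + q ^+ m * qint n.
Proof.
elim: n => [|n IH]; first by rewrite addn0 qint0; ring.
by rewrite addnS !qintS IH exprD; ring.
Qed.

(** Equating the two Pascal rules gives this identity multiplied by 1 - q,
    which is not a zero divisor. *)
Lemma qbin_swap k f : qint f.+1 * qbin k f.+1 = qint k.+1 * qbin k.+1 f.
Proof.
have nz1X : 1 - q != 0.
  by rewrite -opprB oppr_eq0 polyXsubC_eq0.
apply: (mulfI nz1X); rewrite !mulrA !qint_geometric.
have := qbinS_dual k f; rewrite qbinS => E.
have -> : (1 - q ^+ f.+1) * qbin k f.+1 =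
  qbin k f.+1 + q ^+ k.+1 * qbin k.+1 f - q ^+ f.+1 * qbin k f.+1
  - q ^+ k.+1 * qbin k.+1 f by ring.
by rewrite E; ring.
Qed.

Lemma qbin_absorb k f :
  qint k.+1 * qbin k.+1 f = qint (k + f).+1 * qbin k f.
Proof.
case: f => [|f]; first by rewrite !qbinn addn0.
rewrite qbinS mulrDr mulrCA -qbin_swap -addSn qintD; ring.
Qed.

(** * Sums over bit strings *)

(** Splitting off the last bit rather than the first: the major index weighs a
    descent by its distance to the start of the word, so only removing the last
    letter leaves the weights of the other descents unchanged. *)
Lemma big_tuple_rcons (R : nmodType) m (F : seq bool -> R) :
  \sum_(b : m.+1.-tuple bool) F b =
  \sum_(b : m.-tuple bool) F (rcons b true)
  + \sum_(b : m.-tuple bool) F (rcons b false).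
Proof.
pose rv n (b : n.-tuple bool) := [tuple of rev b].
have rvK n : involutive (@rv n) by move=> b; apply: val_inj; rewrite /= revK.
rewrite (reindex_inj (inv_inj (@rvK _))) /=.
have red c : \sum_(b : m.-tuple bool) F (rcons b c)
           = \sum_(b : m.-tuple bool) F (rev (c :: b)).
  rewrite (reindex_inj (inv_inj (@rvK _))) /=.
  by apply: eq_bigr => b _; rewrite rev_cons.
rewrite !red.
pose f (p : bool * m.-tuple bool) : m.+1.-tuple bool := [tuple of p.1 :: p.2].
rewrite (reindex f) /=; last first.
  exists (fun t => (thead t, [tuple of behead t])) => [[c b] _|t _].
    by rewrite /f theadE; congr pair; apply: val_inj.
  by rewrite [RHS]tuple_eta; apply: val_inj.
by rewrite -(pair_bigA _ (fun c (b : m.-tuple bool) => F (rev (c :: b)))) big_bool.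
Qed.

Lemma count_rcons (b : seq bool) c : count id (rcons b c) = (count id b + c)%N.
Proof. by rewrite -cats1 count_cat /= addn0. Qed.

(** * Inserting equal letters of intermediate size

    In this section a word over [T] receives copies of one new letter, encoded
    as [None], that lies below the [hi] letters of [T] and above the others. *)

Section Words.

Variables (T : Type) (hi : pred T) (g : rel T).

(** Descents between letters: low letters, then [None], then [hi] letters, with
    [g] deciding inside the low and inside the high class. *)
Definition gt_mid (x y : option T) : bool :=
  match x, y with
  | Some a, Some b => if hi a == hi b then g a b else hi a
  | Some a, None => hi a
  | None, Some b => ~~ hi b
  | None, None => false
  end.

Definition wmaj (u : seq (option T)) : nat :=
  (\sum_(i < (size u).-1 | gt_mid (nth None u i) (nth None u i.+1)) i.+1)%N.

Lemma wmaj_rcons u x y :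
  wmaj (rcons (rcons u x) y) =
  (wmaj (rcons u x) + gt_mid x y * (size u).+1)%N.
Proof.
rewrite /wmaj !size_rcons /= big_mkcond big_ord_recr /= -big_mkcond /=.
congr addn; last first.
  rewrite !nth_rcons size_rcons ltnSn ltnn eqxx ltnn eqxx.
  by case: gt_mid; rewrite ?mul1n ?mul0n.
apply: eq_bigl => i /=.
by rewrite [X in gt_mid X _]nth_rcons [X in gt_mid _ X]nth_rcons size_rcons
  !ltnS ltn_ord ltnW.
Qed.

Lemma wmaj1 x : wmaj [:: x] = 0%N.
Proof. by rewrite /wmaj /= big_ord0. Qed.

Lemma wmaj0 : wmaj [::] = 0%N.
Proof. by rewrite /wmaj /= big_ord0. Qed.

(** The bits say which letters come from [w].  The word [w] runs out early
    or has letters left unless the number of [true] bits is the length of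
    [w], a condition that every sum over masks below imposes. *)
Fixpoint weave (b : seq bool) (w : seq T) : seq (option T) :=
  match b, w with
  | [::], _ => [::]
  | true :: b', x :: w' => Some x :: weave b' w'
  | _ :: b', _ => None :: weave b' w
  end.

Lemma size_weave b w : size (weave b w) = size b.
Proof. by elim: b w => [|[] b IH] [|x w] //=; rewrite IH. Qed.

Lemma weave_rcons1 b w x : count id b = size w ->
  weave (rcons b true) (rcons w x) = rcons (weave b w) (Some x).
Proof.
elim: b w => [|[] b IH] [|y w] //=; first by move=> [/IH ->].
  by move=> /(IH [::]) /= ->.
by move=> /(IH (_ :: _)) /= ->.
Qed.

Lemma weave_rcons0 b w :
  weave (rcons b false) w = rcons (weave b w) None.
Proof. by elim: b w => [|[] b IH] [|y w] //=; rewrite IH. Qed.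

(** The suffix [y] lets one definition cover the words that are summed over and
    those extended by a prescribed next letter, on which the induction runs. *)
Definition shuffle_sum m w (y : seq (option T)) : {poly int} :=
  \sum_(b : m.-tuple bool | count id b == size w) q ^+ wmaj (weave b w ++ y).

Lemma shuffle_sum_split m w a y :
  shuffle_sum m.+1 (rcons w a) y =
  shuffle_sum m w (Some a :: y) + shuffle_sum m (rcons w a) (None :: y).
Proof.
rewrite /shuffle_sum big_mkcond.
rewrite (big_tuple_rcons m (fun b : seq bool =>
  if count id b == size (rcons w a) then q ^+ wmaj (weave b (rcons w a) ++ y) else 0)).
rewrite size_rcons; congr (_ + _); rewrite [RHS]big_mkcond /=; apply: eq_bigr => b _.
  rewrite count_rcons addn1 eqSS; case: eqP => // E.
  by rewrite weave_rcons1 // cat_rcons.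
by rewrite count_rcons addn0 weave_rcons0 cat_rcons.
Qed.

Lemma shuffle_sum_nil_split m y :
  shuffle_sum m.+1 [::] y = shuffle_sum m [::] (None :: y).
Proof.
rewrite /shuffle_sum big_mkcond.
rewrite (big_tuple_rcons m (fun b : seq bool =>
  if count id b == 0%N then q ^+ wmaj (weave b [::] ++ y) else 0)).
rewrite big1 ?add0r; last by move=> b _; rewrite count_rcons addn1.
rewrite [RHS]big_mkcond /=; apply: eq_bigr => b _.
by rewrite count_rcons addn0 weave_rcons0 cat_rcons.
Qed.

Lemma shuffle_sum_last m w x z :
  shuffle_sum m w [:: x; z] = q ^+ (gt_mid x z * m.+1) * shuffle_sum m w [:: x].
Proof.
rewrite mulr_sumr; apply: eq_bigr => b _.
rewrite -cat_rcons !cats1 wmaj_rcons size_weave size_tuple exprD; ring.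
Qed.

Lemma shuffle_sum_short m w y : (m < size w)%N -> shuffle_sum m w y = 0.
Proof.
move=> lt_mw; rewrite /shuffle_sum big_pred0 // => b; apply/eqP => E.
by have := count_size id b; rewrite E size_tuple leqNgt lt_mw.
Qed.

Lemma shuffle_sum0 y : shuffle_sum 0 [::] y = q ^+ wmaj y.
Proof.
rewrite /shuffle_sum (big_pred1 [tuple]) // => b.
by rewrite tuple0.
Qed.

Definition last_hi (w : seq T) := if w is x :: w' then hi (last x w') else false.

Lemma last_hi_rcons w a : last_hi (rcons w a) = hi a.
Proof. by case: w => //= x w; rewrite last_rcons. Qed.

Let smaj w := wmaj (map Some w).

Lemma smaj_rcons w a b :
  smaj (rcons (rcons w a) b) =
  (smaj (rcons w a) + gt_mid (Some a) (Some b) * (size w).+1)%N.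
Proof. by rewrite /smaj !map_rcons wmaj_rcons size_map. Qed.

(** How a next letter interacts with the last letter of a shuffle.  Every descent
    test that occurs in the recursion on the length involves only the next letter
    and either [None] or the last letter of [w], so the two families of sums
    below, with next letter in [T] and with next letter [None], satisfy a closed
    recursion.  The powers of q that accompany the binomial coefficient are
    found by solving it: they record whether the final letter of [w] lies above
    or below the inserted letters. *)
Lemma shuffle_sum_next m w f : m = (size w + f)%N ->
  (forall a, shuffle_sum m w [:: Some a] =
     q ^+ (smaj (rcons w a) + ~~ hi a * f) * qbin (size w) f) /\
  shuffle_sum m w [:: None] =
     q ^+ (smaj w + last_hi w * size w) * qbin (size w) f.
Proof.
elim: m w f => [|m IH] w f.
  case: w => [|//]; case: f => [|//] _.
  rewrite shuffle_sum0 wmaj1 /smaj /= wmaj0 qbin0 !mulr1.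
  by split=> [a|//]; rewrite shuffle_sum0 !wmaj1 muln0 mulr1.
case/lastP: w => [|w a] /=.
  rewrite add0n => Ef; have [_ IH0] := IH [::] m erefl.
  rewrite /smaj /= wmaj0 !qbin0 mulr1 mul0n expr0 in IH0 *; split=> [a|].
    by rewrite shuffle_sum_nil_split shuffle_sum_last IH0 wmaj1 -Ef.
  by rewrite shuffle_sum_nil_split shuffle_sum_last IH0 mul0n ?mulr1.
rewrite size_rcons addSn => -[Em]; have [IHa _] := IH w f Em.
have {IHa} IHa := IHa a.
have IHn : shuffle_sum m (rcons w a) [:: None] =
    if f is f'.+1 then
      q ^+ (smaj (rcons w a) + hi a * (size w).+1) * qbin (size w).+1 f'
    else 0.
  case: f => [|f'] in Em IHa *.
    by rewrite shuffle_sum_short // size_rcons Em addn0.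
  have [|_ ->] := IH (rcons w a) f'; first by rewrite size_rcons Em addnS.
  by rewrite last_hi_rcons size_rcons.
have pascal z : shuffle_sum m.+1 (rcons w a) [:: z] =
   q ^+ (gt_mid (Some a) z * m.+1 + smaj (rcons w a) + ~~ hi a * f) * qbin (size w) f
   + q ^+ (gt_mid None z * m.+1) * shuffle_sum m (rcons w a) [:: None].
  by rewrite shuffle_sum_split !shuffle_sum_last IHa !exprD; ring.
(* The identity to check depends only on which letters are high and on whether
   [g a b] holds; each case is a power of q times one of the two Pascal rules, or
   is trivial when no letter is inserted. *)
split=> [b|]; rewrite pascal IHn Em => {IHa IHn pascal IH};
  [ rewrite smaj_rcons /=; case: (hi a); case: (hi b); case: (g a b)
  | rewrite last_hi_rcons /=; case: (hi a) ];
  rewrite /= ?mul0n ?mul1n ?addn0 ?add0n; case: f {Em} => [|f] /=;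
  first [ by rewrite !qbinn ?addn0 ?(exprD, exprS, expr0); ring
        | by rewrite qbinS ?(exprD, exprS, expr0); ring
        | by rewrite qbinS_dual ?(exprD, exprS, expr0); ring ].
Qed.

(** The Garsia-Gessel shuffle theorem in the case where one of the two words is
    constant.
    The shuffles are sorted by their last letter, and the two partial sums of
    [shuffle_sum_next] add up by a Pascal rule. *)
Theorem shuffle_major m w f : m = (size w + f)%N ->
  shuffle_sum m w [::] = q ^+ wmaj (map Some w) * qbin (size w) f.
Proof.
case: m => [|m]; case/lastP: w => [|w a] /=; rewrite ?size_rcons //.
- by case: f => // _; rewrite shuffle_sum0 qbin0 mulr1.
- move=> _; rewrite shuffle_sum_nil_split.
  have [_ ->] := @shuffle_sum_next m [::] m erefl.
  by rewrite !qbin0 /smaj addn0.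
rewrite addSn => -[Em]; rewrite shuffle_sum_split.
have [-> _] := shuffle_sum_next Em; rewrite -/(smaj _).
case: f Em => [|f] Em.
  by rewrite shuffle_sum_short ?size_rcons ?Em ?addn0 // muln0 addn0 !qbinn addr0.
have [|_ ->] := @shuffle_sum_next m (rcons w a) f.
  by rewrite size_rcons Em addnS.
rewrite last_hi_rcons size_rcons; case: (hi a) => /=.
  by rewrite mul0n mul1n addn0 qbinS exprD; ring.
by rewrite mul0n mul1n addn0 qbinS_dual exprD; ring.
Qed.

(** This is how a word read off a permutation is recognized as a shuffle: its
    pattern of [None] letters is the mask, its other letters are the content. *)
Lemma map_weave (U : Type) (v : U -> option T) (s : seq U) :
  map v s = weave (map (isSome \o v) s) (pmap v s).
Proof. by elim: s => //= x s ->; case: (v x). Qed.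

End Words.

(** * Transporting a permutation along an increasing map

    For [h] increasing, a permutation of the k letters becomes a permutation of
    the image of [h], extended by the identity. *)

Section Positions.

Variables (k n : nat) (h : 'I_k -> 'I_n).
Hypothesis h_mono : forall i j : 'I_k, (i < j)%N -> (h i < h j)%N.

Definition occ (i : 'I_n) : option 'I_k := [pick j | h j == i].

Lemma increasing_ltn (i j : 'I_k) : (h i < h j)%N = (i < j)%N.
Proof.
case: (ltngtP i j) => [/h_mono-> // | /h_mono lt_ji | /val_inj->].
  by rewrite ltnNge (ltnW lt_ji).
exact: ltnn.
Qed.

Lemma increasing_inj : injective h.
Proof.
move=> i j E; case: (ltngtP i j) => [/h_mono|/h_mono|/val_inj//];
  by rewrite E ltnn.
Qed.

Lemma occP i : if occ i is Some j then h j = i else i \notin codom h.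
Proof.
rewrite /occ; case: pickP => [j /eqP //|no]; apply/codomP => -[j E].
by have := no j; rewrite E eqxx.
Qed.

Lemma ord_enum_sorted m : sorted (fun i j : 'I_m => (i < j)%N) (enum 'I_m).
Proof. by have := iota_ltn_sorted 0 m; rewrite -val_enum_ord sorted_map. Qed.

(** Both lists are increasing after applying [h] and have the same elements. *)
Lemma pmap_occ : pmap occ (enum 'I_n) = enum 'I_k.
Proof.
apply: (inj_map increasing_inj); rewrite (@pmap_filter _ _ occ h); last first.
  by move=> i; have := occP i; case: (occ i).
pose lt m := fun i j : 'I_m => (i < j)%N.
have tr m : transitive (lt m) by move=> ? ? ?; apply: ltn_trans.
apply: (irr_sorted_eq (tr n) (fun i => ltnn i)) => [||i].
- exact: (sorted_filter (tr n) _ (ord_enum_sorted n)).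
- exact: (@homo_sorted _ _ h (lt k) (lt n) h_mono _ (ord_enum_sorted k)).
rewrite mem_filter mem_enum andbT; have := occP i.
case: (occ i) => [j <-|]; first by rewrite map_f // mem_enum.
by move=> out; apply/esym/negbTE; apply: contra out => /mapP[j _ ->]; apply: codom_f.
Qed.

(** The positions outside the image of [h] are the inserted letters. *)
Lemma map_occ :
  map occ (enum 'I_n) = weave [seq i \in codom h | i <- enum 'I_n] (enum 'I_k).
Proof.
rewrite map_weave pmap_occ; congr weave; apply: eq_map => i /=.
have := occP i; case: (occ i) => [j <-|/negbTE -> //].
by rewrite codom_f.
Qed.

Lemma occ_h j : occ (h j) = Some j.
Proof.
by have := occP (h j); case: (occ _) => [i /increasing_inj->|]; rewrite ?codom_f.
Qed.

Lemma occ_out i : i \notin codom h -> occ i = None.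
Proof. by have := occP i; case: (occ i) => // j <-; rewrite codom_f. Qed.

Lemma transport_inj (s : 'S_k) :
  injective (fun i => if occ i is Some j then h (s j) else i).
Proof.
move=> i i'; have := occP i'; have := occP i.
case: (occ i) => [j <-|out_i]; case: (occ i') => [j' <-|out_i'] //.
- by move/increasing_inj/perm_inj->.
- by move=> E; rewrite -E codom_f in out_i'.
- by move=> E; rewrite E codom_f in out_i.
Qed.

Definition transport (s : 'S_k) : 'S_n := perm (@transport_inj s).

Lemma transport_in s j : transport s (h j) = h (s j).
Proof. by rewrite permE occ_h. Qed.

Lemma transport_out s i : i \notin codom h -> transport s i = i.
Proof. by move=> /occ_out E; rewrite permE E. Qed.

Lemma transportI : injective transport.
Proof.
move=> s t E; apply/permP => j; apply: increasing_inj.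
by rewrite -!transport_in E.
Qed.

(** One inclusion is clear, transport is injective, and both sides have k!
    elements: counting replaces the construction of an inverse. *)
Lemma transport_image :
  [set transport s | s : 'S_k] = [set t : 'S_n | perm_on [set i in codom h] t].
Proof.
have cardA : #|[set i in codom h]| = k.
  by rewrite cardsE card_codom ?card_ord //; apply: increasing_inj.
apply/setP/subset_cardP.
  rewrite card_imset; last exact: transportI.
  by rewrite card_Sn cardsE card_perm cardA.
apply/subsetP => _ /imsetP[s _ ->]; rewrite inE.
apply/subsetP => i; rewrite !inE; apply: contraR => /transport_out.
by move->.
Qed.

Lemma transport_support (R : nmodType) (F : 'S_n -> R) :
  \sum_(t : 'S_n | [set i | t i != i] == [set i in codom h]) F t =
  \sum_(s in derangements k) F (transport s).
Proof.
have suppE (t : 'S_n) : ([set i | t i != i] == [set i in codom h]) =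
    (t \in [set transport s | s in derangements k]).
  apply/eqP/imsetP => [supp_t|[s der_s ->]].
    have : t \in [set transport s | s : 'S_k].
      rewrite transport_image inE -supp_t; apply/subsetP => i.
      by rewrite !inE.
    case/imsetP => s _ Et; exists s => //; rewrite inE; apply/forallP => j.
    have : h j \in [set i | t i != i] by rewrite supp_t inE codom_f.
    by rewrite inE Et transport_in (inj_eq increasing_inj).
  apply/setP => i; rewrite !inE; case: (boolP (i \in codom h)).
    case/codomP => j ->; rewrite transport_in (inj_eq increasing_inj).
    by move: der_s; rewrite inE => /forallP->.
  by move=> /transport_out->; rewrite eqxx.
by rewrite (eq_bigl _ _ suppE) big_imset // => s t _ _; apply: transportI.
Qed.

End Positions.

(** To compute the major index it is enough to compare neighbours, so a
    permutation may be replaced by any word with the same descents, even if the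
    order of its letters at distant positions differs. *)
Lemma maj_word (n : nat) (s : 'S_n) (T : Type) (hi : pred T) (g : rel T)
    (v : 'I_n -> option T) :
  (forall i j : 'I_n, j = i.+1 :> nat -> gt_mid hi g (v i) (v j) = (s j < s i)%N) ->
  wmaj hi g (map v (enum 'I_n)) = maj s.
Proof.
case: n s v => [|n] s v gt_v; rewrite /wmaj /maj size_map size_enum_ord.
  by rewrite !big_ord0.
rewrite [RHS]big_mkcond big_ord_recr /= ifF; last first.
  rewrite inE; apply/existsP => -[j /andP[/eqP Ej _]].
  by have := ltn_ord j; rewrite Ej ltnn.
rewrite addn0 -big_mkcond; apply: eq_bigl => i.
pose i1 : 'I_n.+1 := lift ord0 i.
have Ev (j : 'I_n.+1) : nth None (map v (enum 'I_n.+1)) j = v j.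
  by rewrite (nth_map j) ?size_enum_ord // nth_ord_enum.
have -> : i.+1 = i1 :> nat by [].
have -> : nat_of_ord i = widen_ord (leqnSn n) i by [].
rewrite !Ev gt_v // inE; apply/idP/existsP => [lt_s|[j /andP[/eqP Ej]]].
  by exists i1; rewrite eqxx.
by have -> : j = i1 by apply: val_inj.
Qed.

(** * The sum over all permutations, by insertion of the largest value *)

Definition mask n (A : {set 'I_n}) : seq bool := [seq i \in A | i <- enum 'I_n].

Lemma count_mask n (A : {set 'I_n}) : count id (mask A) = #|A|.
Proof. by rewrite count_map cardE -size_filter enumT. Qed.

Lemma sum_masks (R : nmodType) n k (F : seq bool -> R) :
  \sum_(b : n.-tuple bool | count id b == k) F b =
  \sum_(A : {set 'I_n} | #|A| == k) F (mask A).
Proof.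
pose f (A : {set 'I_n}) := [tuple i \in A | i < n].
rewrite (reindex f) /=.
  by apply: eq_big => [A|A _] //; rewrite -count_mask.
exists (fun b => [set i | tnth b i]) => [A _|b _].
  by apply/setP => i; rewrite inE tnth_mktuple.
by apply: eq_from_tnth => i; rewrite tnth_mktuple inE.
Qed.

Definition maj_poly n : {poly int} := \sum_(s : 'S_n) q ^+ maj s.

Lemma lift_strict n (i : 'I_n.+1) (j k : 'I_n) :
  (j < k)%N -> (lift i j < lift i k)%N.
Proof. by rewrite /= /bump; lia. Qed.

Lemma codom_lift n (i : 'I_n.+1) :
  [seq j \in codom (lift i) | j <- enum 'I_n.+1] = mask (~: [set i]).
Proof.
apply: eq_map => j; rewrite !inE; apply/codomP/idP => [[k ->]|].
  by rewrite eq_sym neq_lift.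
by case: (unliftP i j) => [k ->|->]; [exists k | rewrite eqxx].
Qed.

(** The largest value exceeds all others, so it plays the role of [None] for a
    word all of whose letters are low. *)
Lemma maj_insert_max n (s : 'S_n) (i : 'I_n.+1) :
  maj (lift_perm i ord_max s) =
  wmaj pred0 (fun j k => (s k < s j)%N) (weave (mask (~: [set i])) (enum 'I_n)).
Proof.
rewrite -codom_lift -map_occ; last exact: lift_strict.
apply/esym/maj_word => a b _.
have out c : c \notin codom (lift i) -> c = i.
  by case: (unliftP i c) => [k ->|//]; rewrite codom_f.
have := occP (lift i) b; have := occP (lift i) a.
case: (occ _ a) => [a' <-|/out ->]; case: (occ _ b) => [b' <-|/out ->] /=;
  rewrite ?lift_perm_lift ?lift_perm_id ?lift_max ?ltnn //.
- by apply/esym/negbTE; rewrite -leqNgt ltnW.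
- by rewrite ltn_ord.
Qed.

Lemma sum_lift_perm (R : nmodType) n (F : 'S_n.+1 -> R) :
  \sum_(t : 'S_n.+1) F t = \sum_(s : 'S_n) \sum_(i < n.+1) F (lift_perm i ord_max s).
Proof.
pose f (p : 'S_n * 'I_n.+1) := lift_perm p.2 ord_max p.1.
rewrite (reindex f) /=; first by rewrite pair_bigA.
apply/onW_bij/inj_card_bij => [[s i] [t j]|]; last first.
  by rewrite card_prod card_ord !card_Sn factS mulnC.
rewrite /f /= => E; have Eij : i = j.
  apply: (@perm_inj _ (lift_perm j ord_max t)).
  by rewrite lift_perm_id -E lift_perm_id.
rewrite -Eij in E *; congr pair; apply/permP => k.
by apply: (@lift_inj _ ord_max); rewrite -!(lift_perm_lift i) E.
Qed.

Lemma wmaj_values (n : nat) (s : 'S_n) :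
  wmaj pred0 (fun j k => (s k < s j)%N) (map Some (enum 'I_n)) = maj s.
Proof. exact: maj_word. Qed.

(** The case of a single inserted letter in [shuffle_major]; it amounts to
    MacMahon's evaluation of the sum of the major index as a q-factorial. *)
Lemma maj_polyS n : maj_poly n.+1 = qint n.+1 * maj_poly n.
Proof.
rewrite /maj_poly sum_lift_perm mulr_sumr; apply: eq_bigr => s _.
have := @shuffle_major _ pred0 (fun j k => (s k < s j)%N) n.+1 (enum 'I_n) 1.
rewrite size_enum_ord addn1 qbin_qint mulrC wmaj_values => <- //.
rewrite /shuffle_sum size_enum_ord.
under [RHS]eq_bigr do rewrite cats0.
rewrite (sum_masks _ n (fun b : seq bool => q ^+ wmaj _ _ (weave b _))).
(* A mask with a single zero is given by the position of that zero; [ord0] is a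
   default, as the complement of A is never empty. *)
rewrite (reindex_onto (fun i => ~: [set i])
                      (fun A => odflt ord0 [pick i in ~: A])) /=.
  apply: eq_big => [i|i _]; last by rewrite maj_insert_max.
  rewrite cardsC1 card_ord eqxx setCK /=.
  by case: pickP => [j /set1P -> /=|/(_ i)]; rewrite ?eqxx // inE eqxx.
move=> A cA; have /cards1P[i Ei] : #|~: A| == 1%N.
  by rewrite cardsCs setCK card_ord (eqP cA) subSnn.
rewrite Ei; case: pickP => [j /set1P -> /=|/(_ i)]; last by rewrite inE eqxx.
by rewrite -Ei setCK.
Qed.

(** * The sum over all permutations, by fixed points *)

Lemma d_sum n : d n = \sum_(s in derangements n) q ^+ maj s.
Proof.
case: n => //=; rewrite (big_pred1 1%g) => [|s]; first by rewrite /maj big_ord0.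
rewrite inE; have /eqP-> : s == 1%g by apply/eqP/permP => -[].
by rewrite /= eqxx; apply/forallP => -[].
Qed.

(** Here x and y are the values at the adjacent positions i and i + 1.  If i is
    an excedance and i + 1 is not, then y <= i < x; in the opposite case
    x < i + 1 < y.  Neighbours may therefore be compared first by excedance. *)
Lemma excedance_descent i x y : x != i -> y != i.+1 ->
  (if (i < x)%N == (i.+1 < y)%N then (y < x)%N else (i < x)%N) = (y < x)%N.
Proof. by case: (ltnP i x); case: (ltnP i.+1 y) => /=; lia. Qed.

Section Expansion.

Variables (k n : nat) (h : 'I_k -> 'I_n).
Hypothesis h_mono : forall i j : 'I_k, (i < j)%N -> (h i < h j)%N.

(** The high letters of a derangement are its excedances. *)
Definition exc (s : 'S_k) (j : 'I_k) := (j < s j)%N.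

(** A fixed point at i has value i: it exceeds a neighbouring deficiency and is
    exceeded by a neighbouring excedance.  Hence the fixed points behave like
    copies of one letter between the two classes. *)
Lemma maj_transport (s : 'S_k) : s \in derangements k ->
  maj (transport h_mono s) =
  wmaj (exc s) (fun i j => (s j < s i)%N)
    (weave [seq i \in codom h | i <- enum 'I_n] (enum 'I_k)).
Proof.
rewrite inE => /forallP der_s; rewrite -(map_occ h_mono).
apply/esym/maj_word => a b.
have der_h j : h (s j) != h j :> nat.
  by rewrite (inj_eq val_inj) (inj_eq (increasing_inj h_mono)).
have := occP h b; have := occP h a.
case: (occ _ a) => [a' <-|out_a]; case: (occ _ b) => [b' <-|out_b] /= Eb;
  rewrite ?transport_in ?transport_out //= /exc -?(increasing_ltn h_mono) ?Eb.
- by apply: excedance_descent; rewrite // -Eb.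
- have : h (s a') != b :> nat.
    by apply: contraNneq out_b => /val_inj <-; apply: codom_f.
  by rewrite Eb; have := der_h a'; lia.
- have : h (s b') != a :> nat.
    by apply: contraNneq out_a => /val_inj <-; apply: codom_f.
  by have := der_h b'; rewrite Eb; lia.
- by rewrite ltnNge leqW.
Qed.

End Expansion.

Lemma wmaj_derangement n (s : 'S_n) : s \in derangements n ->
  wmaj (exc s) (fun i j => (s j < s i)%N) (map Some (enum 'I_n)) = maj s.
Proof.
rewrite inE => /forallP der_s; apply: maj_word => i j /= Ej.
by rewrite /exc Ej; apply: excedance_descent; rewrite -?Ej; apply: der_s.
Qed.

Lemma enum_val_strict n (A : {set 'I_n}) (i j : 'I_#|A|) :
  (i < j)%N -> (Order.enum_val i < Order.enum_val j)%N.
Proof.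
rewrite !ltnNge; apply: contra.
by have := @Order.le_enum_val _ 'I_n (@Order.TotalTheory.le_total _ _) A j i;
  rewrite !leEord => ->.
Qed.

Lemma codom_enum_val n (A : {set 'I_n}) :
  [set i in codom (@Order.enum_val _ _ A)] = A.
Proof.
apply/setP => i; rewrite inE; apply/codomP/idP => [[j ->]|Ai].
  exact: Order.enum_valP.
by exists (Order.enum_rank_in Ai i); rewrite Order.enum_rankK_in.
Qed.

(** Permutations are sorted by the set of their non-fixed positions; those with
    set A are the derangements of #|A| letters transported to A.  Summing over
    all sets A of a given size with the derangement held fixed is a shuffle
    sum. *)
Theorem fixed_point_expansion n :
  maj_poly n = \sum_(k < n.+1) qbin k (n - k) * d k.
Proof.
pose G k b := \sum_(s in derangements k)
  q ^+ wmaj (exc s) (fun i j => (s j < s i)%N) (weave b (enum 'I_k)).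
have supp_sum (A : {set 'I_n}) :
    \sum_(t : 'S_n | [set i | t i != i] == A) q ^+ maj t = G #|A| (mask A).
  have := transport_support (@enum_val_strict n A) (fun t => q ^+ maj t).
  rewrite codom_enum_val => ->; apply: eq_bigr => s /maj_transport->.
  congr (q ^+ wmaj _ _ (weave _ _)); apply: eq_map => i.
  by rewrite -[in RHS](codom_enum_val A) inE.
rewrite /maj_poly (partition_big (fun t : 'S_n => [set i | t i != i]) predT) //=.
under eq_bigr do rewrite supp_sum.
have leA (A : {set 'I_n}) : (#|A| < n.+1)%N.
  by rewrite ltnS -[X in (_ <= X)%N]card_ord max_card.
rewrite (partition_big (fun A : {set 'I_n} => Ordinal (leA A)) predT) //=.
apply: eq_bigr => k _.
transitivity (\sum_(A : {set 'I_n} | #|A| == k) G k (mask A)).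
  by apply: eq_big => // A /eqP <-.
rewrite -(sum_masks _ k (G k)) exchange_big d_sum mulr_sumr /=.
apply: eq_bigr => s der_s.
have := @shuffle_major _ (exc s) (fun i j => (s j < s i)%N) n (enum 'I_k) (n - k).
rewrite size_enum_ord wmaj_derangement // mulrC => <-; last first.
  by rewrite subnKC // -ltnS.
by rewrite /shuffle_sum size_enum_ord; apply: eq_bigr => b _; rewrite cats0.
Qed.

(** * Inversion *)

(** The absorption identity turns [maj_polyS] into a statement on the increments
    of [d] that no longer involves [maj_poly]. *)
Lemma derangement_increment_expansion n :
  \sum_(k < n.+1) qbin k (n - k) * (d k - qint k * d k.-1) = (n == 0%N)%:R.
Proof.
case: n => [|n]; first by rewrite big_ord1 qbin0 qint0 /=; ring.
under eq_bigr do rewrite mulrBr.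
rewrite sumrB -fixed_point_expansion maj_polyS fixed_point_expansion.
rewrite [X in _ - X]big_ord_recl qint0 mul0r mulr0 add0r mulr_sumr.
apply/eqP; rewrite subr_eq0; apply/eqP/eq_bigr => k _ /=.
rewrite /bump add1n subSS !mulrA (mulrC (qbin _ _)) qbin_absorb subnKC //.
by rewrite -ltnS.
Qed.

Definition alt (n : nat) : {poly int} := (-1) ^+ n * q ^+ 'C(n, 2).

Lemma altS n : alt n.+1 = - q ^+ n * alt n.
Proof. by rewrite /alt binS bin1 exprS exprD; ring. Qed.

(** The partial sums of the alternating sum have a closed form because the
    first part of each term under the Pascal rule cancels the previous partial
    sum. *)
Lemma alternating_partial j f :
  \sum_(k < j.+1) qbin k (j + f.+1 - k) * alt k = q ^+ j * alt j * qbin j f.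
Proof.
elim: j f => [|j IH] f.
  by rewrite big_ord1 !qbin0 expr0 mul1r mulr1.
rewrite big_ord_recr /= addKn addSnnS IH qbinS altS exprS; ring.
Qed.

Lemma alternating_expansion n :
  \sum_(k < n.+1) qbin k (n - k) * alt k = (n == 0%N)%:R.
Proof.
case: n => [|n]; first by rewrite big_ord1 qbin0 mul1r /alt mul1r.
rewrite big_ord_recr /=; have := alternating_partial n 0; rewrite addn1 => ->.
by rewrite subnn !qbinn altS; ring.
Qed.

Lemma qbin_unitriangular (c c' : nat -> {poly int}) :
  (forall n, \sum_(k < n.+1) qbin k (n - k) * c k =
             \sum_(k < n.+1) qbin k (n - k) * c' k) ->
  c =1 c'.
Proof.
move=> eq_cc' n; elim/ltn_ind: n => n IH; have := eq_cc' n.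
rewrite !big_ord_recr /= subnn qbinn !mul1r.
under eq_bigr do rewrite IH //.
by move/addrI.
Qed.

(** Both the increments of [d] and the signed powers have the same expansion in
    Gaussian binomial coefficients, which determines a sequence.  At n = 0 the
    predecessor is harmless since [qint 0] vanishes. *)
Lemma d_recurrence n : d n = qint n * d n.-1 + alt n.
Proof.
rewrite addrC; apply/eqP; rewrite -subr_eq; apply/eqP.
apply: (@qbin_unitriangular (fun k => d k - qint k * d k.-1)) => m.
by rewrite derangement_increment_expansion alternating_expansion.
Qed.

Theorem proposition1p7 :
  (forall n : nat, (1 <= n)%N ->
     d n = qint n * d (n - 1)%N + (-1) ^+ n * 'X^('C(n, 2))) /\
  (forall n : nat, (2 <= n)%N ->
     d n = qint (n - 1)%N * (d (n - 1)%N + 'X^(n - 1)%N * d (n - 2)%N)).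
Proof.
split=> [n _|[|[|n]] // _]; first by rewrite d_recurrence subn1.
rewrite !subSS !subn0 d_recurrence /= altS qintS.
by rewrite [in LHS]mulrDl [X in q ^+ _ * X](d_recurrence n.+1) /=; ring.
Qed.
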